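(* For every integer $n\ge 1$, $N(\mathbf{S}^n)\le 3n+2$, and for every integer $\ell\ge 1$, $N(\mathbf{S}^{2\ell-1})\le 3(2\ell-1)+1$.
   Context: $\mathbf{S}^n$ is the $n$-dimensional sphere. A pair of lines in $\mathbf{R}^N$ is skew if they are not parallel and do not intersect (in particular, two equal lines are not skew). A submanifold $M^n\subset\mathbf{R}^N$ (with $C^1$ regularity) is totally skew if every pair of (affine) tangent lines of $M$ is skew, unless they are tangent to $M$ at the same point. A ($C^1$) embedding is totally skew if its image is a totally skew submanifold. $N(M^n)$ denotes the smallest $N$ such that the manifold $M^n$ admits a totally skew embedding in $\mathbf{R}^N$. *)

(* Defs.v *)
From HB Require Import structures.
From mathcomp Require Import all_boot all_order all_algebra.
From mathcomp Require Import all_classical all_reals all_analysis.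

Set Implicit Arguments.
Unset Strict Implicit.
Unset Printing Implicit Defensive.

Import Order.TTheory GRing.Theory Num.Theory.
Import numFieldNormedType.Exports.

Local Open Scope classical_set_scope.
Local Open Scope ring_scope.

(* [f] is C^1 on the open set [U]. For finite-dimensional [V], the only case
   used here, pointwise continuity of ['d f] is its continuity in operator
   norm. *)
Definition C1_on (R : realType) (V W : normedModType R) (U : set V)
    (f : V -> W) : Prop :=
  forall x, U x ->
    differentiable f x /\ forall v : V, {for x, continuous (fun y => 'd f y v)}.

(* For a C^1 submanifold [M], the vectors [v] with [tangent M p v] are the
   elements of T_p M. *)
Definition tangent (R : realType) (m : nat) (M : set 'rV[R]_m)
    (p v : 'rV[R]_m) : Prop :=
  exists (e : R) (c : R -> 'rV[R]_m),
    [/\ 0 < e, C1_on `]-e, e[ c, forall t, t \in `]-e, e[ -> M (c t),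
        c 0 = p & derive1 c 0 = v].

(* [g] is a C^1 extension of [f] restricted to [M], on an open neighbourhood
   [U] of [x]; the differential of [f] at [x] is then the restriction of
   ['d g x] to T_x M, whatever the extension. *)
Definition C1_extension (R : realType) (m N : nat) (M : set 'rV[R]_m)
    (f : 'rV[R]_m -> 'rV[R]_N) (x : 'rV[R]_m) (U : set 'rV[R]_m)
    (g : 'rV[R]_m -> 'rV[R]_N) : Prop :=
  [/\ open U, U x, C1_on U g & forall y, M y -> U y -> g y = f y].

Definition C1_map (R : realType) (m N : nat) (M : set 'rV[R]_m)
    (f : 'rV[R]_m -> 'rV[R]_N) : Prop :=
  forall x, M x -> exists U g, C1_extension M f x U g.

Definition immersive (R : realType) (m N : nat) (M : set 'rV[R]_m)
    (f : 'rV[R]_m -> 'rV[R]_N) : Prop :=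
  forall x U g, M x -> C1_extension M f x U g ->
    forall v, tangent M x v -> 'd g x v = 0 -> v = 0.

Definition homeo_onto_image (R : realType) (m N : nat) (M : set 'rV[R]_m)
    (f : 'rV[R]_m -> 'rV[R]_N) : Prop :=
  {within M, continuous f} /\
  exists h : 'rV[R]_N -> 'rV[R]_m,
    (forall x, M x -> h (f x) = x) /\ {within f @` M, continuous h}.

(* Maps defined on [M] are represented by total functions whose values outside
   [M] are irrelevant. *)
Definition C1_embedding (R : realType) (m N : nat) (M : set 'rV[R]_m)
    (f : 'rV[R]_m -> 'rV[R]_N) : Prop :=
  [/\ C1_map M f, immersive M f & homeo_onto_image M f].

Definition line (R : realType) (N : nat) (p v : 'rV[R]_N) : set 'rV[R]_N :=
  [set p + t *: v | t in [set: R]].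

Definition parallel (R : realType) (N : nat) (L1 L2 : set 'rV[R]_N) : Prop :=
  exists p q v : 'rV[R]_N, [/\ v != 0, L1 = line p v & L2 = line q v].

Definition skew (R : realType) (N : nat) (L1 L2 : set 'rV[R]_N) : Prop :=
  ~ parallel L1 L2 /\ L1 `&` L2 = set0.

Definition tangent_line (R : realType) (N : nat) (M : set 'rV[R]_N)
    (p : 'rV[R]_N) (L : set 'rV[R]_N) : Prop :=
  exists v : 'rV[R]_N, [/\ v != 0, tangent M p v & L = line p v].

(* Meant for a C^1 submanifold [M], such as the image of a C^1 embedding. *)
Definition totally_skew (R : realType) (N : nat) (M : set 'rV[R]_N) : Prop :=
  forall (p q : 'rV[R]_N) (L1 L2 : set 'rV[R]_N),
    M p -> M q -> p <> q -> tangent_line M p L1 -> tangent_line M q L2 ->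
    skew L1 L2.

Definition admits_totally_skew_embedding (R : realType) (m : nat)
    (M : set 'rV[R]_m) (N : nat) : Prop :=
  exists f : 'rV[R]_m -> 'rV[R]_N,
    C1_embedding M f /\ totally_skew (f @` M).

(* [N] is the number N(M). It is kept as a relation because a total function
   would need a default value for the manifolds without such an embedding. *)
Definition is_skew_number (R : realType) (m : nat) (M : set 'rV[R]_m)
    (N : nat) : Prop :=
  admits_totally_skew_embedding M N /\
  forall N', admits_totally_skew_embedding M N' -> (N <= N')%N.

(* The norm of ['rV[R]_n.+1] in the library is the sup norm, hence the explicit
   sum of squares. *)
Definition sphere (R : realType) (n : nat) : set 'rV[R]_n.+1 :=
  [set x : 'rV[R]_n.+1 | \sum_i x ord0 i ^+ 2 = 1].

(* Main.v *)
(* Let B be a symmetric bilinear map with no zero divisors and F x = (x, B x x)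
   on the unit sphere. Parallel tangent lines at F x and F y give a vector u != 0
   with B (x - y) u = 0. If the tangent lines meet, then x + a = y + b with a
   orthogonal to x and b orthogonal to y, and expanding B (x + a) (x + a) =
   B (y + b) (y + b) leaves B (a - b) (a + b) = 0. If a = b, then x = y. If
   a = - b, then y - x = 2 a is orthogonal to both x and y, so again x = y. The
   bounds come from multiplication of real polynomials of degree n
   (R^(n+1) x R^(n+1) -> R^(2n+1)) and of complex polynomials of degree l - 1
   (C^l x C^l -> C^(2l-1)). *)
Require Import Defs.
From HB Require Import structures.
From mathcomp Require Import all_boot all_order all_algebra.
From mathcomp Require Import all_classical all_reals all_analysis.
From mathcomp Require Import zify ring lra.

Set Implicit Arguments.
Unset Strict Implicit.
Unset Printing Implicit Defensive.

Import Order.TTheory GRing.Theory Num.Theory.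
Import numFieldNormedType.Exports.

Local Open Scope classical_set_scope.
Local Open Scope ring_scope.

(** * Continuity and differentials of linear and bilinear maps in finite dimension *)

Section FiniteDimension.
Variables (R : realType) (W : normedModType R).

Lemma linear_rV_continuous m (L : {linear 'rV[R]_m -> W}) : continuous L.
Proof.
have -> : (L : _ -> W) =
    fun x => \sum_(i < m) x ord0 i *: L (delta_mx 0 i).
  apply/funext => x; rewrite {1}(row_sum_delta x) linear_sum.
  by apply: eq_bigr => i _; rewrite linearZ.
apply: continuous_big => [|i _ x]; first exact: add_continuous.
apply: (@cvgZr_tmp _ _ _ (nbhs x)); exact: coord_continuous.
Qed.

Lemma bilinear_rV_continuous m n (B : {bilinear 'rV[R]_m -> 'rV[R]_n -> W}) :
  continuous (fun p : 'rV[R]_m * 'rV[R]_n => B p.1 p.2).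
Proof.
have -> : (fun p : 'rV[R]_m * 'rV[R]_n => B p.1 p.2) =
    fun p => \sum_(i < m) p.1 ord0 i *: B (delta_mx 0 i) p.2.
  apply/funext => p; rewrite {1}(row_sum_delta p.1) linear_sumlz.
  by apply: eq_bigr => i _; rewrite linearZl_LR.
apply: continuous_big => [|i _ p]; first exact: add_continuous.
apply: cvgZ.
  apply: (@cvg_comp _ _ _ fst (fun x : 'rV[R]_m => x ord0 i)).
    exact: cvg_fst.
  exact: coord_continuous.
apply: (@cvg_comp _ _ _ snd (B (delta_mx 0 i))); first exact: cvg_snd.
exact: linear_rV_continuous.
Qed.

(** Chain rule through the diagonal [y |-> (y, y)], followed by the differential of a continuous
    bilinear map. *)
Lemma is_diff_quadratic m (B : {bilinear 'rV[R]_m -> 'rV[R]_m -> W}) x :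
  is_diff x (fun y => B y y) (fun v => B x v + B v x).
Proof.
have cB := bilinear_rV_continuous (B := B).
have dB : is_diff (x, x) (fun p => B p.1 p.2) (fun p => B x p.2 + B p.1 x).
  by apply: DiffDef; [exact: differentiable_bilin|rewrite diff_bilin].
exact: (@is_diff_comp _ _ _ _ (fun y => (y, y)) (fun v => (v, v)) _ _ x).
Qed.

End FiniteDimension.

(** * Velocities of curves and tangent vectors *)

Lemma derive1_comp_diff (R : realType) (V W : normedModType R)
    (c : R -> V) (g : V -> W) t :
  differentiable c t -> differentiable g (c t) ->
  derive1 (g \o c) t = 'd g (c t) (derive1 c t).
Proof.
move=> dc dg; rewrite !derive1E' //; last exact: differentiable_comp.
by rewrite diff_comp.
Qed.

Lemma near_eq_derive1 (R : realType) (V : normedModType R) (c d : R -> V) t :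
  (\near t, c t = d t) -> derive1 c t = derive1 d t.
Proof. by move=> cd; rewrite !derive1E; exact: near_eq_derive. Qed.

Section Tangent.
Variables (R : realType) (m : nat) (M : set 'rV[R]_m).

(** Only the germ of the curve at 0 matters below, so the interval is traded for a neighbourhood
    filter. *)
Lemma tangent_curve p v : tangent M p v ->
  exists c : R -> 'rV[R]_m, [/\ differentiable c 0, \forall t \near 0, M (c t),
    c 0 = p & derive1 c 0 = v].
Proof.
move=> [e [c [e0 C1c Mc c0 dc]]]; exists c.
have e0I : (0 : R) \in `]-e, e[%R by rewrite in_itv/= oppr_lt0 e0.
split=> //; first by have [] := C1c _ e0I.
by near=> t; apply: Mc; rewrite inE; near: t; exact: near_in_itvoo.
Unshelve. all: by end_near. Qed.

End Tangent.

(** * The graph of a quadratic map as a C^1 embedding *)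

Section QuadraticGraph.
Variables (R : realType) (m k : nat).
Variable B : {bilinear 'rV[R]_m -> 'rV[R]_m -> 'rV[R]_k}.

Definition quadratic_graph (x : 'rV[R]_m) : 'rV[R]_(m + k) :=
  row_mx x (B x x).

Lemma is_diff_quadratic_graph x :
  is_diff x quadratic_graph (fun v => row_mx v (B x v + B v x)).
Proof.
(* The two block inclusions are linear, so [row_mx] becomes a sum to which the sum and chain rules
   apply. *)
pose inl : {linear 'rV[R]_m -> 'rV[R]_(m + k)} := mulmxr (row_mx 1%:M 0).
pose inr : {linear 'rV[R]_k -> 'rV[R]_(m + k)} := mulmxr (row_mx 0 1%:M).
have lE u w : inl u + inr w = row_mx u w.
  by rewrite /inl /inr /= !mul_mx_row !mulmx0 !mulmx1 add_row_mx addr0 add0r.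
have dl y : is_diff y inl inl.
  apply: DiffDef; first exact/linear_differentiable/linear_rV_continuous.
  exact/diff_lin/linear_rV_continuous.
have dr y : is_diff y inr inr.
  apply: DiffDef; first exact/linear_differentiable/linear_rV_continuous.
  exact/diff_lin/linear_rV_continuous.
have dB := is_diff_quadratic B x.
have := is_diffD (dl x) (is_diff_comp dB (dr _)).
have -> : (inl : _ -> _) + (inr \o (fun y => B y y)) = quadratic_graph.
  by apply/funext => y; exact: lE.
by have -> : (inl : _ -> _) + (inr \o (fun v => B x v + B v x)) =
  fun v => row_mx v (B x v + B v x) by apply/funext => y; exact: lE.
Qed.

Lemma differentiable_quadratic_graph x : differentiable quadratic_graph x.
Proof. by have [] := is_diff_quadratic_graph x. Qed.

Lemma diff_quadratic_graph x v :
  'd quadratic_graph x v = row_mx v (B x v + B v x).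
Proof. by have [_ ->] := is_diff_quadratic_graph x. Qed.

Lemma C1_quadratic_graph : C1_on setT quadratic_graph.
Proof.
move=> x _; split=> [|v]; first exact: differentiable_quadratic_graph.
(* For a quadratic map the first-order Taylor remainder is the constant [B v v]. The differential is
   thus a finite difference minus a constant, and its continuity in [y] reduces to that of the graph
   map. *)
have -> : (fun y => 'd quadratic_graph y v) = fun y =>
    quadratic_graph (y + v) - quadratic_graph y - row_mx 0 (B v v).
  apply/funext => y; rewrite diff_quadratic_graph /quadratic_graph.
  rewrite !opp_row_mx !add_row_mx linearDl !linearDr/=.
  congr row_mx; first by rewrite subr0 addrAC subrr add0r.
  by apply/rowP => i; rewrite !mxE; ring.
have cF y : {for y, continuous quadratic_graph}.
  exact/differentiable_continuous/differentiable_quadratic_graph.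
apply: continuousB; last exact: cst_continuous.
apply: (continuousB _ (cF x)).
apply: (continuous_comp (f := fun y => y + v)); last exact: cF.
by apply: continuousD; [exact: cvg_id|exact: cst_continuous].
Qed.

Lemma lsubmx_quadratic_graph x : lsubmx (quadratic_graph x) = x.
Proof. exact: row_mxKl. Qed.

Variable M : set 'rV[R]_m.

Lemma homeo_quadratic_graph : homeo_onto_image M quadratic_graph.
Proof.
split; first by apply: continuous_subspaceT => x;
  exact/differentiable_continuous/differentiable_quadratic_graph.
exists lsubmx; split=> [x _|]; first exact: lsubmx_quadratic_graph.
by apply: continuous_subspaceT; exact: continuous_lsubmx.
Qed.

(** The linear map [lsubmx] undoes the graph map. Near 0 the curve is therefore [lsubmx] of its
    image under [g], so its velocity vanishes as soon as ['d g x v] does. *)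
Lemma immersive_quadratic_graph : immersive M quadratic_graph.
Proof.
move=> x U g Mx [oU Ux C1g gE] v /tangent_curve[c [dc Mc c0 <-]] gv0.
have dg : differentiable g (c 0) by rewrite c0; have [] := C1g x Ux.
have Uc : \forall t \near 0, U (c t).
  by apply: (differentiable_continuous dc); rewrite c0; exact: open_nbhs_nbhs.
have dgc : differentiable (g \o c) 0 by exact: differentiable_comp.
have <- : derive1 (lsubmx \o (g \o c)) 0 = derive1 c 0.
  apply: near_eq_derive1; near=> t.
  rewrite /= gE ?lsubmx_quadratic_graph//; near: t; [exact: Mc|exact: Uc].
rewrite derive1_comp_diff//; last exact: differentiable_lsubmx.
by rewrite derive1_comp_diff// c0 gv0 linear0.
Unshelve. all: by end_near. Qed.

Lemma C1_embedding_quadratic_graph : C1_embedding M quadratic_graph.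
Proof.
split; [|exact: immersive_quadratic_graph|exact: homeo_quadratic_graph].
by move=> x _; exists setT, quadratic_graph; split=> //;
  [exact: openT|exact: C1_quadratic_graph].
Qed.

(** A curve in the graph is the lift of its projection by [lsubmx]; the chain rule then computes its
    velocity. *)
Lemma tangent_quadratic_graph p w : tangent (quadratic_graph @` M) p w ->
  exists c : R -> 'rV[R]_m, [/\ differentiable c 0, \forall t \near 0, M (c t),
    p = quadratic_graph (c 0) &
    w = row_mx (derive1 c 0) (B (c 0) (derive1 c 0) + B (derive1 c 0) (c 0))].
Proof.
move=> /tangent_curve[c [dc Mc <- <-]].
have dlc : differentiable (lsubmx \o c) 0.
  by apply: differentiable_comp dc _; exact: differentiable_lsubmx.
have cE : \forall t \near 0, c t = quadratic_graph (lsubmx (c t)).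
  by apply: filterS Mc => t [x _ <-]; rewrite lsubmx_quadratic_graph.
exists (lsubmx \o c); split=> //; last 1 first.
- rewrite -diff_quadratic_graph -derive1_comp_diff//; last first.
    exact: differentiable_quadratic_graph.
  exact: near_eq_derive1.
- by apply: filterS Mc => t [x Mx /= <-]; rewrite lsubmx_quadratic_graph.
- exact: nbhs_singleton cE.
Qed.

End QuadraticGraph.

(** * The Euclidean inner product and velocities on the sphere *)

Section Sphere.
Variable R : realType.

Definition dot m (x y : 'rV[R]_m) : R := \sum_i x ord0 i * y ord0 i.

Lemma dot_bilinear m : bilinear_for
  (GRing.Scale.Law.clone _ _ *:%R _) (GRing.Scale.Law.clone _ _ *:%R _)
  (@dot m : 'rV[R]_m -> 'rV[R]_m -> R).
Proof.
split=> [y|x] a u v; rewrite /dot /= scaler_sumr -big_split/=;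
  apply: eq_bigr => i _; rewrite !mxE /GRing.scale/=; ring.
Qed.

HB.instance Definition _ m :=
  bilinear_isBilinear.Build R _ _ R _ _ (@dot m) (@dot_bilinear m).

Lemma dotC m (x y : 'rV[R]_m) : dot x y = dot y x.
Proof. by apply: eq_bigr => i _; rewrite mulrC. Qed.

Lemma dot_eq0 m (x : 'rV[R]_m) : dot x x = 0 -> x = 0.
Proof.
move=> /psumr_eq0P x0; apply/rowP => i; rewrite mxE.
by apply/eqP; rewrite -sqrf_eq0 expr2 x0// => j _; rewrite -expr2 sqr_ge0.
Qed.

Lemma sphereE n (x : 'rV[R]_n.+1) : @sphere R n x <-> dot x x = 1.
Proof. by rewrite /sphere/= /dot; under eq_bigr do rewrite expr2. Qed.

(** The constant function [dot (c t) (c t)] has derivative twice the inner product of position and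
    velocity. *)
Lemma sphere_velocity n (c : R -> 'rV[R]_n.+1) :
  differentiable c 0 -> (\forall t \near 0, @sphere R n (c t)) ->
  dot (c 0) (derive1 c 0) = 0.
Proof.
move=> dc Sc; have [dq dqE] := is_diff_quadratic (@dot n.+1) (c 0).
have : derive1 ((fun x => dot x x) \o c) 0 = derive1 (cst 1 : R -> R) 0.
  by apply: near_eq_derive1; near=> t; apply/sphereE; near: t.
rewrite derive1_comp_diff// dqE derive1_cst/= [X in _ + X]dotC => /eqP.
by rewrite -mulr2n mulrn_eq0/= => /eqP.
Unshelve. all: by end_near. Qed.

End Sphere.

(** * Total skewness from a symmetric nonsingular bilinear map *)

Section TotallySkew.
Variables (R : realType) (n k : nat).
Variable B : {bilinear 'rV[R]_n.+1 -> 'rV[R]_n.+1 -> 'rV[R]_k}.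
Hypothesis BC : forall x y, B x y = B y x.
Hypothesis B_nonsingular : forall x y, B x y = 0 -> x = 0 \/ y = 0.

Let F := quadratic_graph B.

Lemma quadratic_graph_tangent_lines_disjoint x y u v s t :
  @sphere R n x -> @sphere R n y -> dot x u = 0 -> dot y v = 0 ->
  F x + s *: row_mx u (B x u + B u x) = F y + t *: row_mx v (B y v + B v y) ->
  x = y.
Proof.
move=> /sphereE Sx /sphereE Sy xu yv; rewrite /F /quadratic_graph.
rewrite !scale_row_mx !add_row_mx => /eq_row_mx[].
rewrite (BC u) (BC v) !scalerDr -!linearZr_LR/=.
set a := s *: u; set b := t *: v => e1 e2.
have xa : dot x a = 0 by rewrite linearZr_LR/= xu scaler0.
have yb : dot y b = 0 by rewrite linearZr_LR/= yv scaler0.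
have : B (a - b) (a + b) = 0.
  have : B (x + a) (x + a) = B (y + b) (y + b) by rewrite e1.
  (* By [e2] the expansion reduces to [B a a = B b b], a difference of squares that factors by
     symmetry. *)
  move: e2; rewrite !linearDl !linearDr/= linearNl/= (BC a x) (BC b y) (BC b a).
  rewrite !linearNl => /rowP e2 /rowP e3; apply/rowP => i.
  by move: (e2 i) (e3 i); rewrite !mxE; lra.
move=> /B_nonsingular[/subr0_eq ab|/addr0_eq ab].
  by move: e1; rewrite ab => /addIr.
have xyE : y = x + a + a by rewrite e1 -ab subrK.
have ya : dot y a = 0.
  by move: yb; rewrite -ab linearNr => /eqP; rewrite oppr_eq0 => /eqP.
suff a0 : a = 0 by rewrite xyE a0 !addr0.
apply: dot_eq0; move: ya; rewrite xyE !linearDl/= xa add0r.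
by move=> /eqP; rewrite -mulr2n mulrn_eq0 => /eqP.
Qed.

(** The first blocks give [v = a *: u]; the second blocks then give [B y v = B x v], that is
    [B (y - x) v = 0]. *)
Lemma quadratic_graph_tangent_vectors_independent x y u v a :
  x <> y -> row_mx v (B y v + B v y) = a *: row_mx u (B x u + B u x) -> v = 0.
Proof.
move=> xy; rewrite scale_row_mx => /eq_row_mx[vE].
rewrite scalerDr -linearZr_LR -linearZl_LR/= -vE !(BC v) -!mulr2n => /eqP.
rewrite -subr_eq0 -mulrnBl -scaler_nat scaler_eq0 pnatr_eq0/= -linearBl => /eqP.
by move=> /B_nonsingular[/subr0_eq yx|//]; case: xy.
Qed.

Lemma totally_skew_quadratic_graph : totally_skew (F @` @sphere R n).
Proof.
move=> p q L1 L2 _ _ pq [w [w0 Tw ->]] [w' [w'0 Tw' ->]].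
have [c [dc Sc pE wE]] := tangent_quadratic_graph Tw.
have [d [dd Sd qE w'E]] := tangent_quadratic_graph Tw'.
have cu := sphere_velocity dc Sc; have dv := sphere_velocity dd Sd.
have cd : c 0 <> d 0 by move=> cd; apply: pq; rewrite pE qE cd.
have Sc0 := nbhs_singleton Sc; have Sd0 := nbhs_singleton Sd.
split; last first.
  apply/seteqP; split=> // z [[s _ <-] [t _]]; rewrite pE qE wE w'E => e.
  exact: cd (quadratic_graph_tangent_lines_disjoint Sc0 Sd0 cu dv (esym e)).
move=> [p' [q' [z [z0 l1 l2]]]].
(* Both [r] and [r + y] lie on the common line, so their difference [y] is a multiple of its
   direction [z]. *)
have dir (r r' y : 'rV[R]_(n.+1 + k)) : line r y = line r' z ->
    exists b, y = b *: z.
  move=> l; have : line r y (r + y) by exists 1; rewrite // scale1r.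
  have : line r y r by exists 0; rewrite // scale0r addr0.
  rewrite l => -[s _ sE] [t _]; rewrite -{}sE -addrA => /addrI tE.
  by exists (t - s); rewrite scalerBl tE addrAC subrr add0r.
have [[b wz] [b' w'z]] := (dir _ _ _ l1, dir _ _ _ l2).
have b0 : b != 0 by apply: contraNneq w0 => b0; rewrite wz b0 scale0r.
have : w' = (b' / b) *: w by rewrite wz scalerA divfK.
rewrite wE w'E => /(quadratic_graph_tangent_vectors_independent cd) v0.
by move: w'0; rewrite w'E v0 linear0r linear0l addr0 row_mx0 eqxx.
Qed.

End TotallySkew.

Lemma admits_totally_skew_sphere (R : realType) n k
    (B : {bilinear 'rV[R]_n.+1 -> 'rV[R]_n.+1 -> 'rV[R]_k}) :
  (forall x y, B x y = B y x) -> (forall x y, B x y = 0 -> x = 0 \/ y = 0) ->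
  admits_totally_skew_embedding (@sphere R n) (n.+1 + k).
Proof.
move=> BC B0; exists (quadratic_graph B); split.
  exact: C1_embedding_quadratic_graph.
exact: totally_skew_quadratic_graph.
Qed.

(** Well-ordering of the naturals: [asbool] turns admissibility into a boolean predicate, so a least
    dimension exists. *)
Lemma is_skew_number_le (R : realType) m (M : set 'rV[R]_m) K :
  admits_totally_skew_embedding M K ->
  exists N, is_skew_number M N /\ (N <= K)%N.
Proof.
move=> MK; have exN : exists N, `[< admits_totally_skew_embedding M N >].
  by exists K; apply/asboolP.
case: (ex_minnP exN) => N /asboolP MN minN; exists N; split; last first.
  exact/minN/asboolP.
by split=> // N' MN'; exact/minN/asboolP.
Qed.

(** * Nonsingular products from real and complex polynomials *)

Section PolynomialProducts.
Variable R : realType.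

(** Vectors are coefficient lists of polynomials of degree at most [n]. A product has at most
    [2 * n + 1] coefficients, so [poly_rV] truncates nothing. *)
Definition real_poly_mul n (x y : 'rV[R]_n.+1) : 'rV[R]_(2 * n + 1) :=
  poly_rV (rVpoly x * rVpoly y).

Lemma real_poly_mul_bilinear n : bilinear_for
  (GRing.Scale.Law.clone _ _ *:%R _) (GRing.Scale.Law.clone _ _ *:%R _)
  (@real_poly_mul n).
Proof.
split=> [y|x] a u v; rewrite /real_poly_mul /= linearP.
  by rewrite mulrDl -scalerAl linearP.
by rewrite mulrDr -scalerAr linearP.
Qed.

HB.instance Definition _ n := bilinear_isBilinear.Build R _ _ _ _ _
  (@real_poly_mul n) (@real_poly_mul_bilinear n).

Lemma real_poly_mulC n (x y : 'rV[R]_n.+1) :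
  real_poly_mul x y = real_poly_mul y x.
Proof. by rewrite /real_poly_mul mulrC. Qed.

Lemma poly_rV_eq0 d (p : {poly R}) :
  (size p <= d)%N -> poly_rV p = 0 :> 'rV_d -> p = 0.
Proof. by move=> /poly_rV_K pE p0; rewrite -pE p0 linear0. Qed.

Lemma rVpoly_eq0 d (x : 'rV[R]_d) : rVpoly x = 0 -> x = 0.
Proof. by move=> x0; rewrite -[x]rVpolyK x0 linear0. Qed.

Lemma real_poly_mul_nonsingular n (x y : 'rV[R]_n.+1) :
  real_poly_mul x y = 0 -> x = 0 \/ y = 0.
Proof.
move=> /poly_rV_eq0 xy.
have /eqP : rVpoly x * rVpoly y = 0.
  apply: xy; apply: leq_trans (size_polyMleq _ _) _.
  have [] : (size (rVpoly x) <= n.+1)%N /\ (size (rVpoly y) <= n.+1)%N.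
    by split; exact: size_poly.
  lia.
by rewrite mulf_eq0 => /orP[] /eqP /rVpoly_eq0; [left|right].
Qed.

(** Leading terms of squares cannot cancel over an ordered field: the squares of the two leading
    coefficients would sum to 0. *)
Lemma poly_sum_squares_eq0 (p q : {poly R}) :
  p * p + q * q = 0 -> p = 0 /\ q = 0.
Proof.
move=> /addr0_eq pq.
have : lead_coef p * lead_coef p + lead_coef q * lead_coef q = 0.
  by rewrite -!lead_coefM -pq lead_coefN subrr.
rewrite -!expr2 => /eqP; rewrite paddr_eq0 ?sqr_ge0// !sqrf_eq0 !lead_coef_eq0.
by move=> /andP[/eqP -> /eqP ->].
Qed.

(* A vector of R^(2l) is read as the pair (p, q) of real polynomials of size at
   most [l] that stands for the complex polynomial p + iq. *)
Definition complex_poly_mul l d (x y : 'rV[R]_d) :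
    'rV[R]_((2 * l - 1) + (2 * l - 1)) :=
  let re z := take_poly l (rVpoly z) in let im z := drop_poly l (rVpoly z) in
  row_mx (poly_rV (re x * re y - im x * im y))
         (poly_rV (re x * im y + im x * re y)).

Lemma complex_poly_mul_bilinear l d : bilinear_for
  (GRing.Scale.Law.clone _ _ *:%R _) (GRing.Scale.Law.clone _ _ *:%R _)
  (@complex_poly_mul l d).
Proof.
split=> [y|x] a u v; rewrite /complex_poly_mul /= scale_row_mx add_row_mx;
  rewrite -!linearP; congr (row_mx (poly_rV _) (poly_rV _));
  rewrite !linearP/= -!mul_polyC; ring.
Qed.

HB.instance Definition _ l d := bilinear_isBilinear.Build R _ _ _ _ _
  (@complex_poly_mul l d) (@complex_poly_mul_bilinear l d).

Lemma complex_poly_mulC l d (x y : 'rV[R]_d) :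
  complex_poly_mul l x y = complex_poly_mul l y x.
Proof.
by rewrite /complex_poly_mul; congr (row_mx (poly_rV _) (poly_rV _)); ring.
Qed.

(** The bound on [d] keeps the imaginary parts within size [l]. Leaving [d] free allows
    [(2 * l - 1).+1] later without a cast. *)
Lemma complex_poly_mul_nonsingular l d (x y : 'rV[R]_d) :
  (d <= 2 * l)%N -> complex_poly_mul l x y = 0 -> x = 0 \/ y = 0.
Proof.
move=> dl; rewrite /complex_poly_mul -[RHS]row_mx0 => /eq_row_mx[].
have sre z : (size (take_poly l (rVpoly (z : 'rV[R]_d))) <= l)%N.
  exact: size_take_poly.
have sim z : (size (drop_poly l (rVpoly (z : 'rV[R]_d))) <= l)%N.
  rewrite size_drop_poly; have : (size (rVpoly z) <= d)%N := size_poly _ _.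
  lia.
have smul (p q : {poly R}) : (size p <= l)%N -> (size q <= l)%N ->
    (size (p * q)%R <= 2 * l - 1)%N.
  by move=> sp sq; apply: leq_trans (size_polyMleq _ _) _; lia.
have rV_eq0 z : take_poly l (rVpoly (z : 'rV[R]_d)) = 0 ->
    drop_poly l (rVpoly z) = 0 -> z = 0.
  move=> re0 im0; apply: rVpoly_eq0.
  by rewrite -(poly_take_drop l (rVpoly z)) re0 im0 mul0r addr0.
move: (sre x) (sim x) (sre y) (sim y) (rV_eq0 x) (rV_eq0 y).
set p := take_poly _ _; set q := drop_poly _ _.
set r := take_poly _ _; set s := drop_poly _ _.
move=> sp sq sr ss x_eq0 y_eq0 /poly_rV_eq0 e1 /poly_rV_eq0 e2.
have {}e1 : p * r - q * s = 0.
  by apply: e1; rewrite (leq_trans (size_polyD _ _))// size_polyN geq_max !smul.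
have {}e2 : p * s + q * r = 0.
  by apply: e2; rewrite (leq_trans (size_polyD _ _))// geq_max !smul.
have [pq0|pq0] := eqVneq (p * p + q * q) 0.
  by left; have [p0 q0] := poly_sum_squares_eq0 pq0; exact: x_eq0.
(* Multiplying (p + iq)(r + is) = 0 by the conjugate p - iq gives (p^2 + q^2)(r + is) = 0; its real
   and imaginary parts are the two identities below. *)
right; apply: y_eq0; apply: (mulfI pq0); rewrite mulr0.
  transitivity (p * (p * r - q * s) + q * (p * s + q * r)); first by ring.
  by rewrite e1 e2 !mulr0 addr0.
transitivity (p * (p * s + q * r) - q * (p * r - q * s)); first by ring.
by rewrite e1 e2 !mulr0 subr0.
Qed.

End PolynomialProducts.

Theorem corollary1p3 (R : realType) :
  (forall n : nat, (1 <= n)%N ->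
     exists N : nat,
       is_skew_number (@sphere R n) N /\ (N <= 3 * n + 2)%N) /\
  (forall l : nat, (1 <= l)%N ->
     exists N : nat,
       is_skew_number (@sphere R (2 * l - 1)) N /\
       (N <= 3 * (2 * l - 1) + 1)%N).
Proof.
split=> [n _|l l1].
  (* Here the target has dimension (n + 1) + (2n + 1) = 3n + 2. *)
  have [N [SN leN]] := is_skew_number_le (admits_totally_skew_sphere
    (@real_poly_mulC R n) (@real_poly_mul_nonsingular R n)).
  by exists N; split=> //; lia.
(* Subtraction is truncated, so this needs [l1]. The target dimension is 2l + 2(2l - 1) = 3(2l - 1)
   + 1. *)
have dl : ((2 * l - 1).+1 <= 2 * l)%N by lia.
have [N [SN leN]] := is_skew_number_le (admits_totally_skew_sphere
  (@complex_poly_mulC R l _)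
  (fun x y => @complex_poly_mul_nonsingular R l _ x y dl)).
by exists N; split=> //; lia.
Qed.
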